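(* Let $H$ be a nonzero complex Hilbert space and let $V\subseteq\{\xi\in H:\|\xi\|=1\}$ be a norm-closed set satisfying V1: $\lambda\cdot V\subseteq V$ for every $\lambda\in\mathbb C$ with $|\lambda|=1$; and V2: for $\xi\in H$, if $\langle\xi,\eta\rangle=0$ for all $\eta\in V$ then $\xi=0$. A normal state $\rho$ of $\mathcal B(H)$ is $V$-correlated if and only if $E(\rho)=1$.
   Context: For unit vectors $\xi$, let $\omega_{\xi,\xi}(A)=\langle A\xi,\xi\rangle$, $A\in\mathcal B(H)$. A normal state $\rho$ of $\mathcal B(H)$ is $V$-correlated if for every $\epsilon>0$ there are $n\ge1$, vectors $\xi_1,\dots,\xi_n\in V$ and positive reals $t_1,\dots,t_n$ with $t_1+\cdots+t_n=1$ such that $\|\rho-(t_1\omega_{\xi_1,\xi_1}+\cdots+t_n\omega_{\xi_n,\xi_n})\|\le\epsilon$ (norm of linear functionals on $\mathcal B(H)$). Let $\mathcal K$ be the compact operators on $H$ and $\mathcal A=\{K+\lambda\mathbf 1:K\in\mathcal K,\ \lambda\in\mathbb C\}$. For $X\in\mathcal B(H)$ let $\|X\|_V=\sup_{\xi,\eta\in V}|\langle X\xi,\eta\rangle|$, and for a normal linear functional $\rho$ on $\mathcal B(H)$ define $E(\rho)=\sup\{|\rho(X)|:X\in\mathcal A,\ \|X\|_V\le1\}\in[0,+\infty]$. *)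

(* Defs.v *)
From HB Require Import structures.
From mathcomp Require Import all_boot all_order all_algebra.
From mathcomp Require Import all_classical all_reals all_analysis.
From mathcomp Require Import complex.

Set Implicit Arguments.
Unset Strict Implicit.
Unset Printing Implicit Defensive.

Import Order.TTheory GRing.Theory Num.Theory Num.Def.
Import numFieldNormedType.Exports.

Local Open Scope classical_set_scope.
Local Open Scope ring_scope.

(* The norm of a normed module over R[i] takes its values in R[i]; rnorm is the
   same norm as an element of R.  It is also the modulus on R[i] itself. *)
Definition rnorm (R : realType) (E : normedZmodType R[i]) (x : E) : R :=
  complex.Re `|x|.

Section BoundedOperators.
Variables (R : realType) (H : completeNormedModType R[i]).

Definition bounded_operator : {pred H -> H} :=
  fun X => `[< linear X /\ continuous X >].

Lemma bounded_operator_submod_closed : submod_closed bounded_operator.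
Proof.
split=> [|a X Y].
  apply/asboolP; split=> [b x y|x]; first by rewrite /= scaler0 addr0.
  exact: (@cst_continuous _ _ 0).
move=> /asboolP[lX cX] /asboolP[lY cY]; apply/asboolP; split=> [b x y|x].
  change (a *: X (b *: x + y) + Y (b *: x + y) =
    b *: (a *: X x + Y x) + (a *: X y + Y y)).
  by rewrite lX lY !scalerDr !scalerA mulrC addrACA.
exact: (@continuousD _ _ _ _ _ x (continuousZl_tmp (cX x)) (cY x)).
Qed.

HB.instance Definition _ := GRing.isSubmodClosed.Build R[i] (H -> H)
  bounded_operator bounded_operator_submod_closed.

Record bop := Bop { bop_fun :> H -> H; _ : bop_fun \in bounded_operator }.

HB.instance Definition _ := [isSub for bop_fun].
HB.instance Definition _ := [Choice of bop by <:].
HB.instance Definition _ := [SubChoice_isSubLmodule of bop by <:].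

Lemma idfun_bounded_operator : (idfun : H -> H) \in bounded_operator.
Proof.
by rewrite unfold_in; apply/asboolP; split=> // x; exact: cvg_id.
Qed.

Definition bop1 : bop := Bop idfun_bounded_operator.

Definition opnorm (X : bop) : \bar R :=
  ereal_sup [set (rnorm (X x))%:E | x in [set x : H | rnorm x <= 1]].

Definition functional_norm (phi : bop -> R[i]) : \bar R :=
  ereal_sup [set (rnorm (phi X))%:E | X in [set X | (opnorm X <= 1)%E]].

Definition compact_operator (K : bop) : Prop :=
  precompact (K @` [set x : H | rnorm x <= 1]).

Definition alg_A : set bop :=
  [set X | exists K (lambda : R[i]), compact_operator K /\
             X = K + lambda *: bop1].

End BoundedOperators.

Notation "''B' ( H )" := (bop H) (at level 8, format "''B' ( H )").

Section Functionals.
Variables (R : realType) (H : completeNormedModType R[i]).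
(* dotp is linear in its first argument and conjugate-linear in the second. *)
Variable dotp : {dot H for (@conjC R[i])}.

Definition omega (xi eta : H) (X : 'B(H)) : R[i] := dotp (X xi) eta.

Definition square_summable (xi : nat -> H) : Prop :=
  (\sum_(0 <= k <oo) ((rnorm (xi k)) ^+ 2)%:E < +oo)%E.

Definition ultraweak_form (xi eta : nat -> H) (X : 'B(H)) : R[i] :=
  limn (series (fun k => omega (xi k) (eta k) X : R[i]^o)).

(* Normal functionals are those continuous for the ultraweak topology, which is
   the initial topology for the forms X |-> \sum_k <X xi_k, eta_k> with
   (xi_k), (eta_k) square-summable. *)
Definition ultraweakly_continuous (rho : 'B(H) -> R[i]) : Prop :=
  forall (X : 'B(H)) (e : R), 0 < e ->
  exists (n : nat) (xi eta : 'I_n -> nat -> H) (d : R),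
    [/\ forall i, square_summable (xi i) /\ square_summable (eta i),
        0 < d &
        forall Y : 'B(H),
          (forall i, rnorm (ultraweak_form (xi i) (eta i) Y -
                            ultraweak_form (xi i) (eta i) X) < d) ->
          rnorm (rho Y - rho X) < e].

Definition positive_operator (X : 'B(H)) : Prop :=
  forall x : H, 0 <= dotp (X x) x.

Definition normal_state (rho : {scalar 'B(H)}) : Prop :=
  [/\ forall X, positive_operator X -> 0 <= rho X,
      rho (bop1 H) = 1 &
      ultraweakly_continuous rho].

Variable V : set H.

Definition correlated (rho : 'B(H) -> R[i]) : Prop :=
  forall e : R, 0 < e ->
  exists (n : nat) (xi : 'I_n -> H) (t : 'I_n -> R),
    [/\ (0 < n)%N,
        forall i, V (xi i),
        forall i, 0 < t i,
        \sum_(i < n) t i = 1 &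
        (functional_norm (fun X => (rho X -
           \sum_(i < n) (t i)%:C%C * omega (xi i) (xi i) X)%R) <= e%:E)%E].

Definition Vnorm (X : 'B(H)) : \bar R :=
  ereal_sup [set (rnorm (dotp (X p.1) p.2))%:E | p in V `*` V].

Definition entanglement (rho : 'B(H) -> R[i]) : \bar R :=
  ereal_sup [set (rnorm (rho X))%:E |
               X in [set X | alg_A X /\ (Vnorm X <= 1)%E]].

End Functionals.

(* Main.v *)
(** If rho is V-correlated then |rho X| <= 1 whenever ||X||_V <= 1, by
    approximation, and E(rho) = 1 is attained at X = 1.

    Conversely, E(rho) = 1 says |rho X| <= ||X||_V on A.  Normality yields a
    finite-rank projection P such that rho is uniformly close to
    X |-> rho (P X P) on the unit ball.  On the finite-dimensional space spanned
    by 1 and P B(H) P, which lies in A, convex separation approximates rho by a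
    convex combination of functionals omega_{xi_i, eta_i} with xi_i, eta_i in V;
    V1 turns |<X xi, eta>| into a real part.  Testing on 1 shows that
    sum t_i <xi_i, eta_i> is close to 1, so that sum t_i ||xi_i - eta_i|| is small
    and eta_i may be replaced by xi_i.  Testing on P shows that
    sum t_i ||xi_i - P xi_i|| is small, which passes from P B(H) P to B(H). *)

Require Import Defs.
From mathcomp Require Import all_boot all_order all_algebra.
From mathcomp Require Import all_classical all_reals all_analysis.
From mathcomp Require Import complex ring lra.
Set Implicit Arguments.
Unset Strict Implicit.
Unset Printing Implicit Defensive.

Import Order.TTheory GRing.Theory Num.Theory Num.Def.
Import numFieldNormedType.Exports.
Local Open Scope classical_set_scope.
Local Open Scope ring_scope.

Local Notation Re := complex.Re.
Local Notation Im := complex.Im.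

(** * Norms in R[i] *)

Section Rnorm.
Variables (R : realType) (E : normedZmodType R[i]).
Implicit Types x y : E.

Lemma rnormE x : `|x| = (rnorm x)%:C%C.
Proof. by rewrite RRe_real ?normr_real. Qed.

Lemma rnorm_ge0 x : 0 <= rnorm x.
Proof. by rewrite -lecR -rnormE normr_ge0. Qed.

Lemma rnormD x y : rnorm (x + y) <= rnorm x + rnorm y.
Proof. by rewrite -lecR rmorphD /= -!rnormE ler_normD. Qed.

Lemma rnormN x : rnorm (- x) = rnorm x.
Proof. by rewrite /rnorm normrN. Qed.

Lemma rnormB x y : rnorm (x - y) <= rnorm x + rnorm y.
Proof. by rewrite -[rnorm y]rnormN rnormD. Qed.

Lemma rnorm_distC x y : rnorm (x - y) = rnorm (y - x).
Proof. by rewrite /rnorm distrC. Qed.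

Lemma rnorm_distD y x z : rnorm (x - z) <= rnorm (x - y) + rnorm (y - z).
Proof. by rewrite -[x - z](subrKA y) rnormD. Qed.

Lemma rnorm0 : rnorm (0 : E) = 0.
Proof. by rewrite /rnorm normr0. Qed.

Lemma rnorm_eq0 x : (rnorm x == 0) = (x == 0).
Proof. by rewrite -(inj_eq (@complexI R)) -rnormE normr_eq0. Qed.

Lemma rnorm_sum (I : Type) (r : seq I) (P : pred I) (F : I -> E) :
  rnorm (\sum_(i <- r | P i) F i) <= \sum_(i <- r | P i) rnorm (F i).
Proof.
elim/big_ind2 : _ => [|x1 x2 y1 y2 h1 h2|//]; first by rewrite rnorm0.
exact: le_trans (rnormD _ _) (lerD h1 h2).
Qed.

End Rnorm.

Lemma rnormZ (R : realType) (E : normedModType R[i]) (a : R[i]) (x : E) :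
  rnorm (a *: x) = rnorm a * rnorm x.
Proof. by apply: complexI; rewrite rmorphM /= -!rnormE normrZ. Qed.

Section RnormComplex.
Variable R : realType.
Implicit Types (a : R) (z w : R[i]).

Lemma rnormM z w : rnorm (z * w) = rnorm z * rnorm w.
Proof. by apply: complexI; rewrite rmorphM /= -!rnormE normrM. Qed.

Lemma rnorm_real a : rnorm (a%:C)%C = `|a|.
Proof. by rewrite /rnorm normc_def /= expr0n addr0 sqrtr_sqr. Qed.

Lemma rnorm_sqr z : rnorm z ^+ 2 = Re z ^+ 2 + Im z ^+ 2.
Proof. by apply: complexI; rewrite add_Re2_Im2 rmorphXn /= -rnormE. Qed.

Lemma rnorm_sqr_conj z : ((rnorm z ^+ 2)%:C)%C = z * (z^*)%C.
Proof.
rewrite rnorm_sqr; case: z => a b; apply/eqP; rewrite eq_complex /=.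
by apply/andP; split; apply/eqP; ring.
Qed.

Lemma ler_normRe_rnorm z : `|Re z| <= rnorm z.
Proof.
rewrite -(@ler_pXn2r _ 2) ?nnegrE ?rnorm_ge0//.
by rewrite rnorm_sqr real_normK ?num_real// lerDl sqr_ge0.
Qed.

Lemma ler_Re_rnorm z : Re z <= rnorm z.
Proof. exact: le_trans (ler_norm _) (ler_normRe_rnorm z). Qed.

Lemma ler_normIm_rnorm z : `|Im z| <= rnorm z.
Proof.
rewrite -(@ler_pXn2r _ 2) ?nnegrE ?rnorm_ge0//.
by rewrite rnorm_sqr real_normK ?num_real// lerDr sqr_ge0.
Qed.

Lemma rnorm_le_ReIm z : rnorm z <= `|Re z| + `|Im z|.
Proof.
rewrite -(@ler_pXn2r _ 2) ?nnegrE ?addr_ge0 ?rnorm_ge0//.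
rewrite rnorm_sqr sqrrD !real_normK ?num_real// lerD2r lerDl.
by rewrite mulrn_wge0// mulr_ge0.
Qed.

Lemma ReD z w : Re (z + w) = Re z + Re w.
Proof. by case: z w => a b []. Qed.

Lemma Re_sum (I : Type) (r : seq I) (P : pred I) (F : I -> R[i]) :
  Re (\sum_(i <- r | P i) F i) = \sum_(i <- r | P i) Re (F i).
Proof. exact: (big_morph _ ReD). Qed.

Lemma ReZ a z : Re (a%:C%C * z) = a * Re z.
Proof. by case: z => b c /=; rewrite mul0r subr0. Qed.

End RnormComplex.

(** * Dominated series of complex numbers *)

Section ComplexSeries.
Variables (R : realType) (a : nat -> R[i]) (b : nat -> R) (M : R).
Hypothesis ab : forall k, rnorm (a k) <= b k.
Hypothesis bM : forall n, \sum_(0 <= k < n) b k <= M.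

Let cvg_part (p : R[i] -> R) : (forall z, `|p z| <= rnorm z) ->
  cvgn (series (p \o a)).
Proof.
move=> pz; apply: normed_cvg; apply: nondecreasing_is_cvgn.
  by apply: nondecreasing_series => k _ _; exact: normr_ge0.
exists M => _ [n _ <-]; apply: le_trans (bM n).
by apply: ler_sum => k _; exact: le_trans (pz _) (ab k).
Qed.

(** [limn] is informative only for a convergent sequence, so convergence comes first: the real and
    imaginary parts are dominated by [b], hence their series converge absolutely. The bound then
    passes from the partial sums to the limit. *)
Lemma rnorm_limn_series : rnorm (limn (series (fun k => a k : R[i]^o))) <= M.
Proof.
have cRe := cvg_part (@ler_normRe_rnorm R).
have cIm := cvg_part (@ler_normIm_rnorm R).
set x := limn _ in cRe; set y := limn _ in cIm.
pose s n := \sum_(0 <= k < n) a k.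
have sRe n : Re (s n) = series (@complex.Re R \o a) n by exact: Re_sum.
have sIm n : Im (s n) = series (@complex.Im R \o a) n.
  by apply: (big_morph _ _ erefl) => - [? ?] [].
have near_s (d : R) : 0 < d -> \forall n \near \oo, rnorm ((x +i* y)%C - s n) < d.
  move=> d0; have d2 : 0 < d / 2 by rewrite divr_gt0.
  move/cvgrPdist_lt/(_ _ d2) : cRe => cRe.
  move/cvgrPdist_lt/(_ _ d2) : cIm => cIm.
  near=> n.
  apply: le_lt_trans (rnorm_le_ReIm _) _; rewrite (splitr d).
  have -> : Re ((x +i* y)%C - s n) = x - Re (s n) by case: (s n).
  have -> : Im ((x +i* y)%C - s n) = y - Im (s n) by case: (s n).
  by rewrite sRe sIm; apply: ltrD; near: n.
have -> : limn (series (fun k => a k : R[i]^o)) = (x +i* y)%C.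
  apply: cvg_lim; first exact: norm_hausdorff.
  apply/cvgrPdist_lt => d d0.
  have dE : d = (Re d)%:C%C by rewrite RRe_real ?gtr0_real.
  have := near_s (Re d); rewrite -ltcR -dE => /(_ d0).
  apply: filterS => n; rewrite -ltcR -rnormE -dE; exact.
apply/ler_addgt0Pr => d d0.
have [n] := filter_ex (near_s _ d0).
move=> /ltW h; have hs : rnorm (s n) <= M.
  apply: le_trans (rnorm_sum _ _ _) _; apply: le_trans (bM n).
  by apply: ler_sum => k _.
have := rnormD ((x +i* y)%C - s n) (s n); rewrite subrK => hL.
by rewrite (le_trans hL)// addrC lerD.
Unshelve. all: by end_near. Qed.

End ComplexSeries.

(** * Approximation by convex combinations *)

(** The variance of [r] for the weights [t] is nonnegative, so the squared mean is at most the mean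
    of the squares. *)
Lemma convex_mean_le (R : realType) (n : nat) (t r : 'I_n -> R) (a : R) :
  (forall i, 0 < t i) -> \sum_i t i = 1 -> 0 <= a ->
  \sum_i t i * r i ^+ 2 <= a ^+ 2 -> \sum_i t i * r i <= a.
Proof.
move=> t0 t1 a0 h; set m := \sum_i t i * r i.
have : 0 <= \sum_i t i * (r i - m) ^+ 2.
  by apply: sumr_ge0 => i _; rewrite mulr_ge0 ?sqr_ge0// ltW.
have -> : \sum_i t i * (r i - m) ^+ 2 = \sum_i t i * r i ^+ 2 - m ^+ 2.
  transitivity (\sum_i (t i * r i ^+ 2 - 2 * m * (t i * r i) + m ^+ 2 * t i)).
    by apply: eq_bigr => i _; ring.
  rewrite big_split/= sumrB -!mulr_sumr t1 -/m; ring.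
move=> h2; apply: le_trans (ler_norm _) _.
rewrite -(@ler_pXn2r _ 2) ?nnegrE// real_normK ?num_real//.
by apply: le_trans h; rewrite -subr_ge0.
Qed.

Section ConvexApproximation.
Variables (R : realType) (T : finType) (W : Type).
Variables (p : T -> R[i]) (s : W -> T -> R[i]).

Let mix n (t : 'I_n -> R) (w : 'I_n -> W) (x : T) : R[i] :=
  \sum_i (t i)%:C%C * s (w i) x.

Let dist2 (f : T -> R[i]) : R := \sum_x rnorm (p x - f x) ^+ 2.

Let hull (f : T -> R[i]) := exists (n : nat) (w : 'I_n -> W) (t : 'I_n -> R),
  [/\ (0 < n)%N, forall i, 0 < t i, \sum_i t i = 1 & forall x, f x = mix t w x].

Let hull1 w : hull (s w).
Proof.
exists 1%N, (fun=> w), (fun=> 1); split=> //; first by rewrite big_ord1.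
by move=> x; rewrite /mix big_ord1 mul1r.
Qed.

Let hull_step f w (g : R) : hull f -> 0 < g -> g < 1 ->
  hull (fun x => f x + g%:C%C * (s w x - f x)).
Proof.
move=> [n [v [t [n0 t0 t1 fE]]]] g0 g1.
(* Index [ord0] carries the new point with weight [g]; the old points move to the lifted indices and
   their weights shrink by [1 - g]. *)
exists n.+1, (fun i => if unlift ord0 i is Some j then v j else w),
  (fun i => if unlift ord0 i is Some j then (1 - g) * t j else g).
split=> //.
- by move=> i; case: unlift => [j|//]; rewrite mulr_gt0 ?subr_gt0.
- rewrite big_ord_recl unlift_none.
  under eq_bigr do rewrite liftK.
  by rewrite -mulr_sumr t1; ring.
- move=> x; rewrite /mix big_ord_recl unlift_none.
  under eq_bigr do rewrite liftK rmorphM/= -mulrA.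
  rewrite -mulr_sumr -/(mix t v x) -fE rmorphB/=; ring.
Qed.

(** The Euclidean inner product of C seen as a real plane, that is, the real part of [z] times the
    conjugate of [w]. *)
Let ip (z w : R[i]) : R := Re z * Re w + Im z * Im w.

Let rnorm_step (a b : R[i]) (g : R) :
  rnorm (a - g%:C%C * b) ^+ 2 = rnorm a ^+ 2 - 2 * g * ip a b + g ^+ 2 * rnorm b ^+ 2.
Proof. by rewrite !rnorm_sqr /ip; case: a b => a1 a2 [b1 b2] /=; ring. Qed.

(** A nearest-point argument in C^T for finite [T]: the infimum [d] of the squared distance from [p]
    to the convex hull of the [s w] is zero. The hypothesis on [c] says that no real functional
    strictly separates [p] from this hull; [B] controls the second-order term of a step. *)
Lemma convex_approx (B : R) : inhabited W ->
  (forall w x, rnorm (s w x) <= B) ->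
  (forall (c : T -> R[i]) (d : R), 0 < d ->
    exists w, Re (\sum_x c x * p x) <= Re (\sum_x c x * s w x) + d) ->
  forall eps : R, 0 < eps ->
  exists (n : nat) (w : 'I_n -> W) (t : 'I_n -> R),
    [/\ (0 < n)%N, forall i, 0 < t i, \sum_i t i = 1 &
        forall x, rnorm (p x - \sum_i (t i)%:C%C * s (w i) x) <= eps].
Proof.
move=> [w0] sB sep eps eps0.
pose A := [set dist2 f | f in hull].
have A0 : A !=set0 by exists (dist2 (s w0)), (s w0).
have lbA : lbound A 0.
  by move=> _ [f _ <-]; apply: sumr_ge0 => x _; exact: sqr_ge0.
have infA : has_inf A by split=> //; exists 0.
set d := inf A.
have d_ge0 : 0 <= d by apply: lb_le_inf.
have hullB f x : hull f -> rnorm (f x) <= B.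
  move=> [n [v [t [_ t0 t1 ->]]]]; rewrite /mix (le_trans (rnorm_sum _ _ _))//.
  rewrite -[leRHS]mul1r -t1 mulr_suml ler_sum// => i _.
  by rewrite rnormM rnorm_real gtr0_norm// ler_wpM2l// ltW.
(* For empty [T] nothing fixes the sign of [B], but then all sums over [T] are empty. *)
have B0 : 0 <= B \/ forall x : T, False.
  have [[x _]|h] := pselect (exists x : T, True); last by right=> x; apply: h; exists x.
  by left; exact: le_trans (rnorm_ge0 _) (sB w0 x).
pose D := \sum_(x : T) (B + B) ^+ 2 + 1.
have D0 : 0 < D.
  by rewrite ltr_pwDr// sumr_ge0// => x _; exact: sqr_ge0.
have hD f w : hull f -> \sum_x rnorm (s w x - f x) ^+ 2 <= D.
  move=> hf; apply: (@le_trans _ _ (\sum_(x : T) (B + B) ^+ 2)); last by rewrite lerDl.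
  apply: ler_sum => x _; case: B0 => [B0|/(_ x)//].
  rewrite ler_pXn2r ?nnegrE ?rnorm_ge0 ?addr_ge0//.
  by rewrite (le_trans (rnormB _ _))// lerD// hullB.
(* If d > 0, moving a nearly optimal point f slightly towards a w that
   separates in the direction p - f brings the distance below d. *)
have d0 : d <= 0.
  clear B0.
  rewrite leNgt; apply/negP => d0.
  (* A step of length [g] changes the squared distance by -2gP + g^2 Q with Q <= D, and this [g]
     makes g^2 D <= g d. Since P is at least d - e, the net gain is g d up to three errors of size
     at most [e], which together cost only half of it. *)
  pose g := d / (D + d).
  have Dd : 0 < D + d by rewrite addr_gt0.
  have g0 : 0 < g by rewrite divr_gt0.
  have g1 : g < 1 by rewrite ltr_pdivrMr// mul1r ltrDr.
  have gD : g * (D + d) = d by rewrite divfK ?gt_eqF.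
  pose e := g * d / 6.
  have e0 : 0 < e by rewrite divr_gt0// mulr_gt0.
  have [_ [f hf <-] fd] := inf_adherent e0 infA.
  (* With the conjugate as coefficient, the real part of the sum is the Euclidean inner product with
     [p - f]. *)
  have [w hw] := sep (fun x => ((p x - f x)^*)%C) e e0.
  have := ge_inf (ex_intro _ 0 lbA) (imageP dist2 (hull_step w hf g0 g1)).
  rewrite -/d {1}/dist2.
  under eq_bigr do rewrite opprD addrA rnorm_step.
  rewrite big_split/= sumrB -!mulr_sumr -/(dist2 f).
  set P := \sum_x ip _ _; have := hD f w hf; set Q := \sum_x _ => QD.
  have hP : dist2 f - e <= P.
    suff -> : P = dist2 f + (Re (\sum_x ((p x - f x)^*)%C * s w x) -
        Re (\sum_x ((p x - f x)^*)%C * p x)) by rewrite lerD2l lerBrDr addrC lerBlDr; exact: hw.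
    rewrite !Re_sum -sumrB -big_split/=; apply: eq_bigr => x _.
    rewrite /ip rnorm_sqr.
    by case: (p x) (f x) (s w x) => p1 p2 [f1 f2] [s1 s2] /=; ring.
  have df : d <= dist2 f by apply: ge_inf; [exists 0|exists f].
  have gQ : g ^+ 2 * Q <= g ^+ 2 * D by rewrite ler_wpM2l// sqr_ge0.
  have gP : g * (d - e) <= g * P.
    by rewrite (ler_wpM2l (ltW g0))// (le_trans _ hP)// lerD2r.
  have ge : g * e <= e by rewrite ger_pMl// ltW.
  have gd : 0 < g * d by rewrite mulr_gt0.
  have g2 : g ^+ 2 * D <= g * d.
    rewrite expr2 -mulrA (ler_wpM2l (ltW g0))// -[leRHS]gD.
    by rewrite (ler_wpM2l (ltW g0))// lerDl ltW.
  have eE : e = g * d / 6 by [].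
  by move: fd; rewrite -/d; nra.
clear B0; have e2 : 0 < eps ^+ 2 by rewrite exprn_gt0.
have [_ [f hf <-] fd] := inf_adherent e2 infA.
have [n [w [t [n0 t0 t1 fE]]]] := hf.
exists n, w, t; split=> // x; rewrite -/(mix t w x) -fE.
rewrite -(@ler_pXn2r _ 2) ?nnegrE ?rnorm_ge0 ?(ltW eps0)//.
have : dist2 f <= eps ^+ 2 by move: fd; rewrite -/d; lra.
move=> fe; apply: le_trans fe; rewrite /dist2 (bigD1 x)//= lerDl sumr_ge0// => y _.
exact: sqr_ge0.
Qed.

End ConvexApproximation.

(** * Orthonormal families *)

Section InnerProduct.
Variables (R : realType) (H : completeNormedModType R[i]).
Variable dotp : {dot H for (@conjC R[i])}.
Hypothesis dotp_norm : forall x : H, `|x| ^+ 2 = dotp x x.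
Implicit Types (x y z u v : H) (a : R[i]).

Lemma dotDl x y z : dotp (x + y) z = dotp x z + dotp y z.
Proof. exact: linearDl. Qed.
Lemma dotDr x y z : dotp z (x + y) = dotp z x + dotp z y.
Proof. exact: linearDr. Qed.
Lemma dotBl x y z : dotp (x - y) z = dotp x z - dotp y z.
Proof. exact: linearBl. Qed.
Lemma dotBr x y z : dotp z (x - y) = dotp z x - dotp z y.
Proof. exact: linearBr. Qed.
Lemma dotZl a x y : dotp (a *: x) y = a * dotp x y.
Proof. exact: linearZl_LR. Qed.
Lemma dotZr a x y : dotp x (a *: y) = (a^*)%C * dotp x y.
Proof. exact: linearZr_LR. Qed.
Lemma dot0l x : dotp 0 x = 0.
Proof. exact: linear0l. Qed.
Lemma dot0r x : dotp x 0 = 0.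
Proof. exact: linear0r. Qed.
Lemma dotC x y : dotp x y = ((dotp y x)^*)%C.
Proof. by rewrite hermC mul1r. Qed.

Lemma dot_suml (I : Type) (r : seq I) (P : pred I) (F : I -> H) y :
  dotp (\sum_(i <- r | P i) F i) y = \sum_(i <- r | P i) dotp (F i) y.
Proof. exact: (big_morph (dotp^~ y) (fun x z => dotDl x z y) (dot0l y)). Qed.

Lemma dot_sumr (I : Type) (r : seq I) (P : pred I) (F : I -> H) y :
  dotp y (\sum_(i <- r | P i) F i) = \sum_(i <- r | P i) dotp y (F i).
Proof. exact: (big_morph (dotp y) (fun x z => dotDr x z y) (dot0r y)). Qed.

Lemma dotxx x : dotp x x = (rnorm x ^+ 2)%:C%C.
Proof. by rewrite -dotp_norm rnormE rmorphXn. Qed.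

Lemma rnorm_sqrB x y :
  rnorm (x - y) ^+ 2 = rnorm x ^+ 2 + rnorm y ^+ 2 - 2 * Re (dotp x y).
Proof.
apply: complexI; rewrite -dotxx dotBl !dotBr !dotxx (dotC y x).
rewrite rmorphB rmorphD rmorphM/=.
case: (dotp x y) => a b; apply/eqP; rewrite eq_complex /=.
by apply/andP; split; apply/eqP; ring.
Qed.

Lemma cauchy_schwarz x y : rnorm (dotp x y) <= rnorm x * rnorm y.
Proof.
have [->|y0] := eqVneq y 0; first by rewrite dot0r !rnorm0 mulr0.
have ny : 0 < rnorm y by rewrite lt0r rnorm_ge0 rnorm_eq0 y0.
rewrite -(@ler_pXn2r _ 2) ?nnegrE ?mulr_ge0 ?rnorm_ge0//.
set d := dotp x y.
(* This is |y|^2 times the component of [x] orthogonal to [y], which avoids a division. *)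
have := sqr_ge0 (rnorm ((rnorm y ^+ 2)%:C%C *: x - d *: y)).
rewrite rnorm_sqrB !rnormZ dotZl dotZr -/d [(_^*)%C * _]mulrC -rnorm_sqr_conj.
rewrite ReZ /= rnorm_real ger0_norm ?sqr_ge0// => h.
have {h} : 0 <= rnorm y ^+ 2 * ((rnorm x * rnorm y) ^+ 2 - rnorm d ^+ 2).
  by apply: le_trans h _; rewrite le_eqVlt; apply/orP; left; apply/eqP; ring.
by rewrite pmulr_rge0 ?exprn_gt0// subr_ge0.
Qed.

Definition orthonormal_family (N : nat) (e : 'I_N -> H) :=
  forall j k, dotp (e j) (e k) = (j == k)%:R.

Definition proj (N : nat) (e : 'I_N -> H) x : H := \sum_j dotp x (e j) *: e j.

Lemma dot_proj N (e : 'I_N -> H) x y :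
  dotp (proj e x) y = \sum_j dotp x (e j) * dotp (e j) y.
Proof. by rewrite dot_suml; apply: eq_bigr => j _; rewrite dotZl. Qed.

Lemma dot_projC N (e : 'I_N -> H) x y : dotp (proj e x) y = dotp x (proj e y).
Proof.
rewrite dot_proj dot_sumr; apply: eq_bigr => j _.
by rewrite dotZr -dotC mulrC.
Qed.

Lemma proj_projE N (e : 'I_N -> H) j x : orthonormal_family e ->
  dotp (proj e x) (e j) = dotp x (e j).
Proof.
move=> oe; rewrite dot_proj (bigD1 j)//= oe eqxx mulr1 big1 ?addr0// => k kj.
by rewrite oe (negPf kj) mulr0.
Qed.

Lemma dot_proj_self N (e : 'I_N -> H) x :
  dotp x (proj e x) = (\sum_j rnorm (dotp x (e j)) ^+ 2)%:C%C.
Proof.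
rewrite -dot_projC dot_proj rmorph_sum; apply: eq_bigr => j _.
by rewrite (dotC (e j)) -rnorm_sqr_conj.
Qed.

Lemma rnorm_proj_sqr N (e : 'I_N -> H) x : orthonormal_family e ->
  rnorm (proj e x) ^+ 2 = \sum_j rnorm (dotp x (e j)) ^+ 2.
Proof.
move=> oe; apply: complexI; rewrite -dotxx -dot_proj_self dot_projC.
by rewrite !dot_sumr; apply: eq_bigr => j _; rewrite !dotZr proj_projE.
Qed.

Lemma rnorm_sub_proj N (e : 'I_N -> H) x : orthonormal_family e ->
  rnorm (x - proj e x) ^+ 2 = rnorm x ^+ 2 - rnorm (proj e x) ^+ 2.
Proof.
move=> oe; rewrite rnorm_sqrB dot_proj_self /= -rnorm_proj_sqr//.
ring.
Qed.

Lemma rnorm_proj_le N (e : 'I_N -> H) x : orthonormal_family e ->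
  rnorm (proj e x) <= rnorm x.
Proof.
move=> oe; rewrite -(@ler_pXn2r _ 2) ?nnegrE ?rnorm_ge0//.
by rewrite -subr_ge0 -rnorm_sub_proj// sqr_ge0.
Qed.

(** Gram-Schmidt, one vector at a time: a vector already in the span adds nothing, any other adds
    its normalized orthogonal residue. The condition [proj e v = v] expresses that [v] lies in the
    span. *)
Lemma exists_orthonormal (s : seq H) :
  exists (N : nat) (e : 'I_N -> H), orthonormal_family e /\
    forall v, v \in s -> proj e v = v.
Proof.
elim: s => [|v s [N [e [oe es]]]].
  by exists 0%N, (fun=> 0); split=> // - [].
pose w := v - proj e v.
have wv : v = w + proj e v by rewrite /w subrK.
have we j : dotp w (e j) = 0 by rewrite dotBl proj_projE// subrr.
have [w0|w0] := eqVneq w 0.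
  exists N, e; split=> // x; rewrite inE => /predU1P[->|/es//].
  by rewrite [RHS]wv w0 add0r.
have nw : (rnorm w)%:C%C != 0 :> R[i].
  by rewrite -[0]/((0 : R)%:C%C) (inj_eq (@complexI R)) rnorm_eq0.
pose u := ((rnorm w)%:C%C)^-1 *: w.
have wu : w = (rnorm w)%:C%C *: u by rewrite /u scalerA divff// scale1r.
have ue j : dotp u (e j) = 0 by rewrite dotZl we mulr0.
have uu : dotp u u = 1.
  rewrite dotxx rnormZ -[_%:C%C^-1]fmorphV /= rnorm_real.
  rewrite ger0_norm ?invr_ge0 ?rnorm_ge0// mulVf ?expr1n//.
  by rewrite rnorm_eq0.
have eu j : dotp (e j) u = 0 by rewrite dotC ue conjc0.
pose f (j : 'I_N.+1) := if unlift ord0 j is Some i then e i else u.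
have f0 : f ord0 = u by rewrite /f unlift_none.
have fl i : f (lift ord0 i) = e i by rewrite /f liftK.
have pf x : proj f x = dotp x u *: u + proj e x.
  rewrite /proj big_ord_recl f0; congr (_ + _).
  by apply: eq_bigr => i _; rewrite fl.
exists N.+1, f; split=> [j k|x].
  case: (unliftP ord0 j) => [j'|] ->; case: (unliftP ord0 k) => [k'|] ->.
  - by rewrite !fl oe (inj_eq lift_inj).
  - by rewrite fl f0 eu.
  - by rewrite fl f0 ue.
  - by rewrite f0 uu eqxx.
rewrite inE pf => /predU1P[->|xs].
  rewrite [RHS]wv; congr (_ + _); rewrite [RHS]wu; congr (_ *: _).
  rewrite {1}wv dotDl dot_proj big1 ?addr0; last by move=> j _; rewrite eu mulr0.
  by rewrite {1}wu dotZl uu mulr1.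
(* An earlier vector lies in the span of [e], which is orthogonal to [u], so its coefficient on [u]
   vanishes. *)
rewrite (es _ xs) -{1}(es _ xs) dot_proj big1 ?scale0r ?add0r// => j _.
by rewrite eu mulr0.
Qed.

(** * Bounded and compact operators *)

Lemma lipschitz_linear_continuous (f : H -> H) (M : R) : linear f ->
  (forall x, rnorm (f x) <= M * rnorm x) -> continuous f.
Proof.
move=> lf fM x; apply/cvgrPdist_lt => eps eps0.
have fB t : f x - f t = f (x - t).
  by rewrite [LHS]addrC -[- f t]scaleN1r -lf scaleN1r addrC.
have M0 : 0 < (`|M| + 1)%:C%C :> R[i] by rewrite ltcR ltr_pwDr.
near=> t; rewrite fB rnormE.
apply: (@le_lt_trans _ _ ((`|M| + 1)%:C%C * `|x - t|)).
  rewrite rnormE -rmorphM/= lecR (le_trans (fM _))// ler_wpM2r ?rnorm_ge0//.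
  by rewrite (le_trans (ler_norm _))// lerDl.
rewrite mulrC -ltr_pdivlMr//; near: t.
by apply: cvgr_dist_lt => //; rewrite divr_gt0.
Unshelve. all: by end_near. Qed.

Implicit Types (X Y : 'B(H)).

Lemma bopP X : linear X /\ continuous X.
Proof. by case: X => f /= fP; apply/asboolP. Qed.

Lemma bopD X x y : X (x + y) = X x + X y.
Proof. by have [+ _] := bopP X => /(_ 1 x y); rewrite !scale1r. Qed.

Lemma bop0 X : X 0 = 0.
Proof. by apply: (addrI (X 0)); rewrite -bopD !addr0. Qed.

Lemma bopZ X a x : X (a *: x) = a *: X x.
Proof. by have [+ _] := bopP X => /(_ a x 0); rewrite bop0 !addr0. Qed.

Lemma bopB X x y : X (x - y) = X x - X y.
Proof. by rewrite -scaleN1r bopD bopZ scaleN1r. Qed.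

Lemma bop_sum X (I : Type) (r : seq I) (P : pred I) (F : I -> H) :
  X (\sum_(i <- r | P i) F i) = \sum_(i <- r | P i) X (F i).
Proof. exact: (big_morph X (bopD X) (bop0 X)). Qed.

Lemma addbE X Y x : (X + Y) x = X x + Y x. Proof. by []. Qed.
Lemma subbE X Y x : (X - Y) x = X x - Y x. Proof. by []. Qed.
Lemma scalebE a X x : (a *: X) x = a *: X x. Proof. by []. Qed.

Lemma sumbE (I : Type) (r : seq I) (P : pred I) (F : I -> 'B(H)) x :
  (\sum_(i <- r | P i) F i) x = \sum_(i <- r | P i) F i x.
Proof. exact: (big_morph (fun X : 'B(H) => X x) (fun X Y => addbE X Y x) erefl). Qed.

Lemma bop_bounded X : exists2 M : R, 0 < M & forall x, rnorm (X x) <= M * rnorm x.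
Proof.
have [_ /(_ 0)] := bopP X.
move=> /cvgrPdist_lt/(_ 1 ltr01); rewrite bop0 => /nbhs_normP[d /= d0 dX].
have dE : d = (Re d)%:C%C by rewrite RRe_real ?gtr0_real.
have d1 : 0 < Re d by rewrite -ltcR -dE.
exists (2 / Re d); first by rewrite divr_gt0.
move=> x; have [->|x0] := eqVneq x 0; first by rewrite bop0 !rnorm0 mulr0.
have nx : 0 < rnorm x by rewrite lt0r rnorm_ge0 rnorm_eq0 x0.
(* Scaling by [c] brings [x] to norm [Re d / 2], inside the ball on which [X] has norm below 1. *)
pose c := Re d / 2 / rnorm x.
have c0 : 0 < c by rewrite !divr_gt0.
have := dX (c%:C%C *: x).
rewrite /ball_ /= !sub0r !normrN !rnormE !rnormZ bopZ rnormZ rnorm_real gtr0_norm//.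
rewrite [X in _ < X -> _]dE !ltcR => /(_ _)/ltW.
have -> : c * rnorm x = Re d / 2 by rewrite /c divfK ?gt_eqF.
move=> /(_ _); rewrite -ler_pdivlMl// mulr1 => h.
have -> : 2 / Re d * rnorm x = c^-1.
  by rewrite /c !invfM !invrK; ring.
by apply: h; lra.
Qed.

Lemma rnorm_le_opnorm X (M : R) x : (opnorm X <= M%:E)%E ->
  rnorm (X x) <= M * rnorm x.
Proof.
move=> XM; have [->|x0] := eqVneq x 0; first by rewrite bop0 !rnorm0 mulr0.
have nx : 0 < rnorm x by rewrite lt0r rnorm_ge0 rnorm_eq0 x0.
have cE : rnorm (((rnorm x)^-1)%:C%C *: x) = 1.
  rewrite rnormZ rnorm_real ger0_norm ?invr_ge0 ?rnorm_ge0//.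
  by rewrite mulVf ?gt_eqF.
have : ((rnorm (X (((rnorm x)^-1)%:C%C *: x)))%:E <= M%:E)%E.
  apply: le_trans XM; apply: ereal_sup_ubound; exists (((rnorm x)^-1)%:C%C *: x) => //=.
  by rewrite cE.
rewrite lee_fin bopZ rnormZ rnorm_real ger0_norm ?invr_ge0 ?rnorm_ge0//.
by rewrite mulrC ler_pdivrMr.
Qed.

Lemma opnorm_le X (M : R) : 0 <= M -> (forall x, rnorm (X x) <= M * rnorm x) ->
  (opnorm X <= M%:E)%E.
Proof.
move=> M0 XM; apply: ge_ereal_sup => _ [x /= x1 <-].
by rewrite lee_fin (le_trans (XM x))// ler_piMr.
Qed.

(** * Rank-one operators, compactness and the algebra [alg_A] *)

Section RankOne.
Variables u v : H.

Let rank1_fun x : H := dotp x u *: v.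

Lemma rank1_bounded : rank1_fun \in @bounded_operator R H.
Proof.
have l1 : linear rank1_fun.
  by move=> a x y; rewrite /rank1_fun dotDl dotZl scalerDl scalerA.
rewrite unfold_in; apply/asboolP; split=> //.
apply: (@lipschitz_linear_continuous _ (rnorm u * rnorm v)) => // x.
rewrite rnormZ mulrAC ler_wpM2r ?rnorm_ge0// mulrC; exact: cauchy_schwarz.
Qed.

Definition rank1 : 'B(H) := Bop rank1_bounded.

End RankOne.

Lemma compact_operator0 : compact_operator (0 : 'B(H)).
Proof.
apply: (@precompact_subset _ _ [set 0]); first by move=> _ [x _ <-].
by apply: compact_precompact; [exact: norm_hausdorff|exact: compact_set1].
Qed.

(** The image of the unit ball lies in the image, under the continuous addition, of a product of two
    compact closures. *)
Lemma compact_operatorD X Y : compact_operator X -> compact_operator Y ->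
  compact_operator (X + Y).
Proof.
rewrite /compact_operator !precompactE => cX cY.
rewrite -precompactE.
set A := closure _ in cX; set B := closure _ in cY.
apply: (@precompact_subset _ _ ((fun p : H * H => p.1 + p.2) @` (A `*` B))).
  move=> _ [x x1 <-]; exists (X x, Y x) => //; split; apply: subset_closure;
  by exists x.
apply: compact_precompact; first exact: norm_hausdorff.
apply: continuous_compact; last exact: compact_setX.
by apply: continuous_subspaceT => p; exact: add_continuous.
Qed.

(** By Cauchy-Schwarz the image of the unit ball lies in the image of a compact square of
    coefficients (real and imaginary part bounded by [rnorm u]) under a continuous map into the line
    of [v]. *)
Lemma compact_rank1 u v : compact_operator (rank1 u v).
Proof.
pose M := rnorm u.
pose f (p : R * R) : H := (p.1 +i* p.2)%C *: v.
apply: (@precompact_subset _ _ (f @` (`[- M, M] `*` `[- M, M]))).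
  move=> _ [x /= x1 <-]; exists (Re (dotp x u), Im (dotp x u)); last first.
    by rewrite /f /=; case: (dotp x u).
  have h : rnorm (dotp x u) <= M.
    by rewrite (le_trans (cauchy_schwarz _ _))// ler_piMl ?rnorm_ge0.
  split; rewrite /= in_itv/= -ler_norml.
    exact: le_trans (ler_normRe_rnorm _) h.
  exact: le_trans (ler_normIm_rnorm _) h.
apply: compact_precompact; first exact: norm_hausdorff.
apply: continuous_compact; last by apply: compact_setX; exact: segment_compact.
apply: continuous_subspaceT => p; apply/cvgrPdist_lt => eps eps0.
have eE : eps = (Re eps)%:C%C by rewrite RRe_real ?gtr0_real.
have e1 : 0 < Re eps by rewrite -ltcR -eE.
(* Chosen so that [(d + d) * (rnorm v + 1)] is [Re eps]; the added 1 covers [v = 0]. *)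
pose d := Re eps / (2 * (rnorm v + 1)).
have v1 : 0 < rnorm v + 1 by rewrite ltr_wpDl ?rnorm_ge0.
have d0 : 0 < d by rewrite divr_gt0// mulr_gt0.
have h1 : \forall q \near p, `|p.1 - q.1| < d.
  have /cvgrPdist_lt/(_ _ d0) : (fst : R * R -> R) @ p --> p.1 by exact: cvg_fst.
  by [].
have h2 : \forall q \near p, `|p.2 - q.2| < d.
  have /cvgrPdist_lt/(_ _ d0) : (snd : R * R -> R) @ p --> p.2 by exact: cvg_snd.
  by [].
near=> q.
have q1 : `|p.1 - q.1| < d by near: q.
have q2 : `|p.2 - q.2| < d by near: q.
rewrite rnormE eE ltcR /f -scalerBl rnormZ.
have := rnorm_le_ReIm ((p.1 +i* p.2)%C - (q.1 +i* q.2)%C) => /=.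
move=> hpq; apply: (@le_lt_trans _ _ ((d + d) * rnorm v)).
  by rewrite ler_wpM2r ?rnorm_ge0// (le_trans hpq)// ltW// ltrD.
rewrite (@lt_le_trans _ _ ((d + d) * (rnorm v + 1)))//.
  by rewrite ltr_pM2l ?addr_gt0// ltrDl.
by rewrite /d -mulr2n -mulr_natl le_eqVlt; apply/orP; left; apply/eqP; field; rewrite gt_eqF.
Unshelve. all: by end_near. Qed.

Lemma compact_operatorZ a X : compact_operator X -> compact_operator (a *: X).
Proof.
rewrite /compact_operator [in X in X -> _]precompactE => cX.
apply: (@precompact_subset _ _ ( *:%R a @` closure (X @` [set x | rnorm x <= 1]))).
  by move=> _ [x x1 <-]; exists (X x) => //; apply: subset_closure; exists x.
apply: compact_precompact; first exact: norm_hausdorff.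
apply: continuous_compact cX.
by apply: continuous_subspaceT; exact: scaler_continuous.
Qed.

Lemma alg_A_rank1 u v : alg_A (rank1 u v).
Proof.
by exists (rank1 u v), 0; split; [exact: compact_rank1|rewrite scale0r addr0].
Qed.

Lemma alg_A_bop1 : @alg_A R H (bop1 H).
Proof.
by exists 0, 1; split; [exact: compact_operator0|rewrite add0r scale1r].
Qed.

Lemma alg_AZ a X : alg_A X -> alg_A (a *: X).
Proof.
move=> [K [l [cK ->]]]; exists (a *: K), (a * l).
by split; [exact: compact_operatorZ|rewrite scalerDr scalerA].
Qed.

Lemma alg_AD X Y : alg_A X -> alg_A Y -> alg_A (X + Y).
Proof.
move=> [K [l [cK ->]]] [L [m [cL ->]]]; exists (K + L), (l + m).
by split; [exact: compact_operatorD|rewrite scalerDl addrACA].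
Qed.

Lemma alg_A_sum (I : Type) (r : seq I) (P : pred I) (F : I -> 'B(H)) :
  (forall i, alg_A (F i)) -> alg_A (\sum_(i <- r | P i) F i).
Proof.
move=> AF; elim/big_ind : _ => //; last exact: alg_AD.
by rewrite -(scale0r (bop1 H)); apply: alg_AZ; exact: alg_A_bop1.
Qed.

(* P X P for the orthogonal projection P onto the span of e. *)
Definition compress N (e : 'I_N -> H) X : 'B(H) :=
  \sum_(p : 'I_N * 'I_N) dotp (X (e p.2)) (e p.1) *: rank1 (e p.2) (e p.1).

(** Links the two uses of [compress]: the expansion in rank-one operators, on which linear
    functionals are computed, and the form P X P, which gives the norm estimates. *)
Lemma compressE N (e : 'I_N -> H) X x : compress e X x = proj e (X (proj e x)).
Proof.
rewrite /compress sumbE /proj bop_sum.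
rewrite -(pair_bigA _ (fun j k => (dotp (X (e k)) (e j) *: rank1 (e k) (e j)) x)) /=.
apply: eq_bigr => j _; rewrite dot_suml scaler_suml; apply: eq_bigr => k _.
by rewrite bopZ dotZl mulrC -scalerA.
Qed.

(** * Normal functionals *)

(** The partial sums increase and are bounded; [K] is an index where they are within [d] of their
    supremum. *)
Lemma square_summable_tail (xi : nat -> H) (d : R) : square_summable xi -> 0 < d ->
  exists K, forall n, \sum_(K <= k < n) rnorm (xi k) ^+ 2 <= d.
Proof.
rewrite /square_summable; set s := (\sum_(0 <= k <oo) _)%E => sfin d0.
have a0 k : (0 <= ((rnorm (xi k)) ^+ 2)%:E)%E by rewrite lee_fin sqr_ge0.
have s0 : (0 <= s)%E by apply: nneseries_ge0 => k _ _.
pose S n := \sum_(0 <= k < n) rnorm (xi k) ^+ 2.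
have Ss n : S n <= fine s.
  rewrite -lee_fin fineK ?ge0_fin_numE// -sumEFin.
  exact: (@nneseries_lim_ge _ _ xpredT).
have supS : has_sup (range S).
  by split; [exists (S 0%N), 0%N|exists (fine s) => _ [n _ <-]].
have [_ [K _ <-] SK] := sup_adherent d0 supS.
exists K => n; have [nK|/ltnW Kn] := leqP n K; first by rewrite big_geq// ltW.
have : S n <= sup (range S) by apply: sup_upper_bound => //; exists n.
rewrite /S (big_cat_nat _ Kn)//= -/(S K) => h.
by move: SK h => /=; lra.
Qed.

(** The unit ball of operators, stated pointwise to avoid extended real suprema. *)
Definition contraction X := forall x, rnorm (X x) <= rnorm x.

Lemma compress_contraction N (e : 'I_N -> H) X : orthonormal_family e ->
  contraction X -> contraction (compress e X).
Proof.
move=> oe cX x; rewrite compressE (le_trans (rnorm_proj_le _ oe))//.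
exact: le_trans (cX _) (rnorm_proj_le _ oe).
Qed.

Lemma dot_compress N (e : 'I_N -> H) X x y :
  dotp (compress e X x) y = dotp (X (proj e x)) (proj e y).
Proof. by rewrite compressE dot_projC. Qed.

Lemma ultraweak_form0 (xi eta : nat -> H) : ultraweak_form dotp xi eta 0 = 0.
Proof.
apply/eqP; rewrite -rnorm_eq0 eq_le rnorm_ge0 andbT.
apply: (@rnorm_limn_series _ _ (fun=> 0)) => [k|n]; last by rewrite big1.
by rewrite /omega dot0l rnorm0.
Qed.

(** Take for [s] the first K vectors of both sequences: the projection fixes them, so the first K
    terms vanish. The remaining terms are bounded by the square-summable tails, uniformly over
    contractions. *)
Lemma ultraweak_form_compress (xi eta : nat -> H) (d : R) :
  square_summable xi -> square_summable eta -> 0 < d ->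
  exists s : seq H, forall N (e : 'I_N -> H), orthonormal_family e ->
    (forall v, v \in s -> proj e v = v) -> forall X, contraction X ->
    rnorm (ultraweak_form dotp xi eta (X - compress e X)) <= d.
Proof.
move=> sxi seta d0; have d2 : 0 < d / 2 by rewrite divr_gt0.
have [K1 hK1] := square_summable_tail sxi d2.
have [K2 hK2] := square_summable_tail seta d2.
pose K := maxn K1 K2.
have tail (f : nat -> H) K' n : (K' <= K)%N ->
    (forall n, \sum_(K' <= k < n) rnorm (f k) ^+ 2 <= d / 2) ->
    \sum_(K <= k < n) rnorm (f k) ^+ 2 <= d / 2.
  move=> KK h; have [nK|/ltnW Kn] := leqP n K; first by rewrite big_geq// ltW.
  apply: le_trans (h n); rewrite [leRHS](@big_cat_nat _ _ _ K)//= lerDr.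
  by apply: sumr_ge0 => k _; exact: sqr_ge0.
exists ([seq xi k | k <- iota 0 K] ++ [seq eta k | k <- iota 0 K]) => N e oe es X cX.
pose b k := if (k < K)%N then 0 else rnorm (xi k) ^+ 2 + rnorm (eta k) ^+ 2.
apply: (@rnorm_limn_series _ _ b) => [k|n]; rewrite /b; last first.
  have [nK|/ltnW Kn] := leqP n K.
    rewrite big_nat big1 ?ltW// => k /andP[_ kn].
    by rewrite (leq_trans kn nK).
  rewrite (big_cat_nat _ Kn)//= big_nat big1 ?add0r; last first.
    by move=> k /andP[_ ->].
  rewrite big_nat (eq_bigr (fun k => rnorm (xi k) ^+ 2 + rnorm (eta k) ^+ 2)).
    rewrite -big_nat big_split/= (splitr d) lerD//.
      by apply: tail hK1; exact: leq_maxl.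
    by apply: tail hK2; exact: leq_maxr.
  by move=> k /andP[Kk _]; rewrite ltnNge Kk.
rewrite /omega subbE dotBl dot_compress; case: ltnP => kK.
  rewrite !es ?subrr ?rnorm0// mem_cat; apply/orP; [right|left];
  by apply: map_f; rewrite mem_iota.
apply: le_trans (rnormB _ _) _.
have h1 : rnorm (dotp (X (xi k)) (eta k)) <= rnorm (xi k) * rnorm (eta k).
  apply: le_trans (cauchy_schwarz _ _) _.
  by rewrite ler_wpM2r ?rnorm_ge0.
have h2 : rnorm (dotp (X (proj e (xi k))) (proj e (eta k))) <=
    rnorm (xi k) * rnorm (eta k).
  apply: le_trans (cauchy_schwarz _ _) _.
  rewrite ler_pM ?rnorm_ge0 ?rnorm_proj_le//.
  by rewrite (le_trans (cX _))// rnorm_proj_le.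
(* Each of the two terms is at most the product of the norms, and twice a product is at most the sum
   of the squares. *)
have := sqr_ge0 (rnorm (xi k) - rnorm (eta k)).
by move: h1 h2; nra.
Qed.

(** Continuity at 0 involves finitely many forms; one orthonormal family spanning the vectors needed
    for all of them makes [X - compress e X] small in each. *)
Lemma ultraweak_compress (rho : {scalar 'B(H)}) (d : R) :
  ultraweakly_continuous dotp rho -> 0 < d ->
  exists N (e : 'I_N -> H), orthonormal_family e /\
    forall X, contraction X -> rnorm (rho X - rho (compress e X)) < d.
Proof.
move=> crho d0; have [n [xi [eta [r [ss r0 hr]]]]] := crho 0 d d0.
have r2 : 0 < r / 2 by rewrite divr_gt0.
pose P i (s : seq H) := forall N (e : 'I_N -> H), orthonormal_family e ->
    (forall v, v \in s -> proj e v = v) -> forall X, contraction X ->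
    rnorm (ultraweak_form dotp (xi i) (eta i) (X - compress e X)) <= r / 2.
have /choice[s sP] : forall i, exists s, P i s.
  by move=> i; have [h1 h2] := ss i; exact: ultraweak_form_compress.
have [N [e [oe es]]] := exists_orthonormal (flatten [seq s i | i <- enum 'I_n]).
exists N, e; split=> // X cX; rewrite -linearB -[X in rnorm X]subr0 -[in X in _ - X](linear0 rho).
apply: hr => i; rewrite ultraweak_form0 subr0.
apply: (@le_lt_trans _ _ (r / 2)); last by rewrite ltr_pdivrMr// ltr_pMr// ltr1n.
apply: (sP i) => // v vs; apply: es; apply/flattenP; exists (s i) => //.
by apply: map_f; rewrite mem_enum.
Qed.

(** * Mixtures of vector functionals *)

Lemma bop1E x : bop1 H x = x. Proof. by []. Qed.

Lemma scalar_sumZ (f : {scalar 'B(H)}) (I : finType) (P : pred I)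
    (c : I -> R[i]) (F : I -> 'B(H)) :
  f (\sum_(i | P i) c i *: F i) = \sum_(i | P i) c i * f (F i).
Proof. by rewrite linear_sum; apply: eq_bigr => i _; rewrite linearZ. Qed.

Lemma omega_sumZ (x y : H) (I : finType) (P : pred I)
    (c : I -> R[i]) (F : I -> 'B(H)) :
  omega dotp x y (\sum_(i | P i) c i *: F i) =
  \sum_(i | P i) c i * omega dotp x y (F i).
Proof.
by rewrite /omega sumbE dot_suml; apply: eq_bigr => i _; rewrite scalebE dotZl.
Qed.

Lemma omega_contraction X x y : contraction X -> rnorm x = 1 -> rnorm y = 1 ->
  rnorm (omega dotp x y X) <= 1.
Proof.
move=> cX x1 y1; rewrite (le_trans (cauchy_schwarz _ _))// y1 mulr1.
by rewrite (le_trans (cX _))// x1.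
Qed.

Lemma opnorm_contraction X : (opnorm X <= 1)%E -> contraction X.
Proof. by move=> /rnorm_le_opnorm h x; rewrite -[leRHS]mul1r. Qed.

Lemma opnorm_scale_le1 X (M : R) : 0 < M ->
  (forall x, rnorm (X x) <= M * rnorm x) -> (opnorm (M^-1%:C%C *: X) <= 1)%E.
Proof.
move=> M0 XM; apply: opnorm_le => // x; rewrite mul1r scalebE rnormZ rnorm_real.
by rewrite gtr0_norm ?invr_gt0// mulrC ler_pdivrMr// mulrC.
Qed.

Section Mixtures.
Variables (n : nat) (t : 'I_n -> R) (xi : 'I_n -> H).
Hypothesis t_gt0 : forall i, 0 < t i.
Hypothesis xi1 : forall i, rnorm (xi i) = 1.

Definition mixture (eta : 'I_n -> H) X : R[i] :=
  \sum_i (t i)%:C%C * omega dotp (xi i) (eta i) X.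

Lemma rnorm_mixture (f : 'I_n -> R[i]) (r : 'I_n -> R) :
  (forall i, rnorm (f i) <= r i) ->
  rnorm (\sum_i (t i)%:C%C * f i) <= \sum_i t i * r i.
Proof.
move=> fr; rewrite (le_trans (rnorm_sum _ _ _))// ler_sum// => i _.
by rewrite rnormM rnorm_real gtr0_norm// ler_wpM2l// ltW.
Qed.

Lemma mixture_sumZ (eta : 'I_n -> H) (I : finType) (P : pred I)
    (c : I -> R[i]) (F : I -> 'B(H)) :
  mixture eta (\sum_(j | P j) c j *: F j) = \sum_(j | P j) c j * mixture eta (F j).
Proof.
rewrite /mixture; under eq_bigr do rewrite omega_sumZ mulr_sumr.
rewrite exchange_big; apply: eq_bigr => j _; rewrite mulr_sumr.
by apply: eq_bigr => i _; rewrite mulrCA.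
Qed.

Lemma mixture_swap (eta : 'I_n -> H) X : contraction X ->
  rnorm (mixture eta X - mixture xi X) <= \sum_i t i * rnorm (xi i - eta i).
Proof.
move=> cX; rewrite -sumrB; under eq_bigr do rewrite -mulrBr.
apply: rnorm_mixture => i; rewrite /omega -dotBr (le_trans (cauchy_schwarz _ _))//.
rewrite rnorm_distC ler_piMl ?rnorm_ge0// (le_trans (cX _))// xi1.
by [].
Qed.

(** The change in each vector functional splits into two terms, each at most the distance from
    [xi i] to its projection; hence the factor 2. *)
Lemma mixture_compress N (e : 'I_N -> H) X : orthonormal_family e -> contraction X ->
  rnorm (mixture xi (compress e X) - mixture xi X) <=
  2 * \sum_i t i * rnorm (xi i - proj e (xi i)).
Proof.
move=> oe cX; rewrite -sumrB; under eq_bigr do rewrite -mulrBr.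
rewrite mulr_sumr; under [leRHS]eq_bigr do rewrite mulrCA.
apply: rnorm_mixture => i; rewrite /omega dot_compress rnorm_distC.
set x := xi i; set y := proj e x.
have -> : dotp (X x) x - dotp (X y) y =
    dotp (X (x - y)) x + dotp (X y) (x - y).
  by rewrite bopB dotBl dotBr addrA subrK.
rewrite (le_trans (rnormD _ _))// mulr_natl mulr2n lerD//.
  by rewrite (le_trans (cauchy_schwarz _ _))// xi1 mulr1.
rewrite (le_trans (cauchy_schwarz _ _))// ler_piMl ?rnorm_ge0//.
by rewrite (le_trans (cX _))// -(xi1 i) rnorm_proj_le.
Qed.

Hypothesis t_sum : \sum_i t i = 1.

(** For unit vectors the squared distance is twice 1 - Re<xi, eta>, so the value at the identity
    controls the mean square, and [convex_mean_le] then controls the mean. *)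
Lemma mixture_swap_bound (eta : 'I_n -> H) (d : R) : 0 <= d ->
  (forall i, rnorm (eta i) = 1) ->
  rnorm (1 - mixture eta (bop1 H)) <= d ^+ 2 / 2 ->
  \sum_i t i * rnorm (xi i - eta i) <= d.
Proof.
move=> d0 eta1 h; apply: convex_mean_le => //.
have -> : \sum_i t i * rnorm (xi i - eta i) ^+ 2 =
    2 * (\sum_i t i - Re (mixture eta (bop1 H))).
  rewrite Re_sum -sumrB mulr_sumr; apply: eq_bigr => i _.
  by rewrite rnorm_sqrB xi1 eta1 ReZ /omega bop1E; ring.
have := le_trans (ler_Re_rnorm _) h.
have -> (w : R[i]) : Re (1 - w) = 1 - Re w by case: w.
by rewrite t_sum; lra.
Qed.

(** By Pythagoras |xi - P xi|^2 = 1 - <P xi, xi>, and P is [compress e (bop1 H)]; [convex_mean_le]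
    passes from squares to the mean. *)
Lemma mixture_compress_bound N (e : 'I_N -> H) (d : R) : orthonormal_family e ->
  0 <= d -> rnorm (1 - mixture xi (compress e (bop1 H))) <= d ^+ 2 ->
  \sum_i t i * rnorm (xi i - proj e (xi i)) <= d.
Proof.
move=> oe d0 h; apply: convex_mean_le => //.
have -> : \sum_i t i * rnorm (xi i - proj e (xi i)) ^+ 2 =
    Re (1 - mixture xi (compress e (bop1 H))).
  have -> (w : R[i]) : Re (1 - w) = 1 - Re w by case: w.
  rewrite -[1 in RHS]t_sum Re_sum -sumrB; apply: eq_bigr => i _.
  by rewrite rnorm_sub_proj// xi1 ReZ /omega dot_compress bop1E dotxx /=; ring.
exact: le_trans (ler_Re_rnorm _) h.
Qed.

End Mixtures.

(** * The two implications between V-correlation and [entanglement] equal to 1 *)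

Section Entanglement.
Variable V : set H.
Hypothesis V_unit : forall xi, V xi -> `|xi| = 1.
Variable rho : {scalar 'B(H)}.
Hypothesis rho1 : rho (bop1 H) = 1.

Let V1r x : V x -> rnorm x = 1.
Proof. by move=> /V_unit; rewrite rnormE => -[]. Qed.

Lemma correlated_entanglement :
  correlated dotp V rho -> entanglement dotp V rho = 1%:E.
Proof.
move=> cor; apply/eqP; rewrite eq_le; apply/andP; split.
  apply: ge_ereal_sup => _ [X [_ XV] <-]; rewrite lee_fin.
  have [M M0 XM] := bop_bounded X.
  apply/ler_addgt0Pr => eps eps0.
  (* The approximation is in functional norm, so at [X], of norm at most [M], its error grows by a
     factor [M]. *)
  have [n [xi [t [n0 Vxi t0 t1 h]]]] := cor (eps / M) (divr_gt0 eps0 M0).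
  have hX : rnorm (mixture t xi xi X) <= 1.
    rewrite -t1; under [leRHS]eq_bigr do rewrite -[t _]mulr1.
    apply: rnorm_mixture => [//|i]; rewrite -lee_fin; apply: le_trans XV.
    by apply: ereal_sup_ubound; exists (xi i, xi i); [split; exact: Vxi|].
  have : rnorm (rho X - mixture t xi xi X) <= eps.
    set Y := (M^-1)%:C%C *: X.
    have Y1 : (opnorm Y <= 1)%E by exact: opnorm_scale_le1.
    have : ((rnorm (rho Y - mixture t xi xi Y))%:E <= (eps / M)%:E)%E.
      by apply: le_trans h; apply: ereal_sup_ubound; exists Y.
    have -> : rho Y - mixture t xi xi Y = (M^-1)%:C%C * (rho X - mixture t xi xi X).
      rewrite mulrBr /Y linearZ /mixture mulr_sumr; congr (_ - _).
      by apply: eq_bigr => i _; rewrite /omega scalebE dotZl mulrCA.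
    rewrite lee_fin rnormM rnorm_real gtr0_norm ?invr_gt0// mulrC ler_pM2r//.
    by rewrite invr_gt0.
  have := rnormD (rho X - mixture t xi xi X) (mixture t xi xi X).
  by rewrite subrK; lra.
apply: ereal_sup_ubound; exists (bop1 H); last by rewrite rho1 rnorm_real normr1.
split; first exact: alg_A_bop1.
apply: ge_ereal_sup => _ [[x y] [/= Vx Vy] <-]; rewrite lee_fin.
by apply: (@omega_contraction (bop1 H) x y) => //; exact: V1r.
Qed.

Hypothesis V1 : forall (lambda : R[i]) (xi : H), `|lambda| = 1 -> V xi ->
  V (lambda *: xi).
Hypothesis rhoE : entanglement dotp V rho = 1%:E.

Let pairs := {p : H * H | V p.1 /\ V p.2}.

(** This is the separation hypothesis of [convex_approx]. If it failed, every |<X x, y>| over V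
    would be below M = Re (rho X) - d, which is positive because V is inhabited; then X / M would
    have V-norm at most 1 while |rho (X / M)| > 1. *)
Lemma exists_nearly_norming X (d : R) : inhabited pairs -> alg_A X -> 0 < d ->
  exists p : pairs,
    Re (rho X) <= Re (omega dotp (sval p).1 (sval p).2 X) + d.
Proof.
move=> [p0] AX d0; apply/not_existsP => hn.
have abs (x y : H) : V x -> V y -> rnorm (omega dotp x y X) < Re (rho X) - d.
  move=> Vx Vy; set z := omega dotp x y X.
  (* The phase [l] makes the value real and nonnegative, and V1 absorbs it into the first vector. *)
  have [l l1 lz] : exists2 l : R[i], `|l| = 1 & l * z = `|z|.
    have [->|z0] := eqVneq z 0; first by exists 1; rewrite ?normr1// mulr0 normr0.
    by exists (`|z| / z); rewrite ?divfK// normrM normfV normr_id divff ?normr_eq0.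
  have Vp : V (l *: x, y).1 /\ V (l *: x, y).2 by split=> //=; exact: V1.
  have := hn (exist _ (l *: x, y) Vp); rewrite /= {1}/omega bopZ dotZl -/z lz.
  by move=> /negP; rewrite -ltNge rnormE/= ltrBrDr.
set M := Re (rho X) - d in abs.
have M0 : 0 < M.
  by have [Vx Vy] := svalP p0; exact: le_lt_trans (rnorm_ge0 _) (abs _ _ Vx Vy).
have : ((rnorm (rho ((M^-1)%:C%C *: X)))%:E <= 1%:E)%E.
  rewrite -rhoE; apply: ereal_sup_ubound; exists ((M^-1)%:C%C *: X) => //; split.
    exact: alg_AZ.
  apply: ge_ereal_sup => _ [[x y] [/= Vx Vy] <-].
  rewrite dotZl rnormM rnorm_real gtr0_norm ?invr_gt0// lee_fin.
  by rewrite mulrC ler_pdivrMr// mul1r ltW// abs.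
rewrite lee_fin linearZ rnormM rnorm_real gtr0_norm ?invr_gt0//.
rewrite mulrC ler_pdivrMr// mul1r.
by have := ler_Re_rnorm (rho X); rewrite /M; lra.
Qed.

Lemma entanglement_correlated : inhabited pairs ->
  ultraweakly_continuous dotp rho -> correlated dotp V rho.
Proof.
move=> W0 crho eps eps0.
(* The final error is a^2/2 for compressing [rho], a^2/2 on the compressed operators and 2a for
   undoing the compression, in all at most 3a since [a <= 1]. *)
pose a := Num.min 1 (eps / 3).
have a0 : 0 < a by rewrite lt_min ltr01 divr_gt0.
have a1 : a <= 1 by rewrite ge_min lexx.
have a3 : a <= eps / 3 by rewrite ge_min lexx orbT.
have a2 : 0 < a ^+ 2 / 2 by rewrite divr_gt0// exprn_gt0.
have [N [e [oe he]]] := ultraweak_compress crho a2.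
have e1 j : rnorm (e j) = 1.
  have := dotxx (e j); rewrite oe eqxx => -[/esym/eqP].
  by rewrite sqrp_eq1 ?rnorm_ge0// => /eqP.
pose m : R := #|{: 'I_N * 'I_N}|%:R.
have m1 : 0 < m + 1 by rewrite ltr_wpDl.
(* On a compressed operator each of the [m] rank-one terms costs at most b^2/2 <= b, and replacing
   [eta] by [xi] costs [b] once more, whence the factor [m + 1]. *)
pose b := Num.min 1 (a ^+ 2 / 2 / (m + 1)).
have b0 : 0 < b by rewrite lt_min ltr01 divr_gt0.
have b1 : b <= 1 by rewrite ge_min lexx.
have bm : b * (m + 1) <= a ^+ 2 / 2 by rewrite -ler_pdivlMr// ge_min lexx orbT.
(* A finite index type for the identity ([None]) and the rank-one operators that span P B(H) P
   ([Some]). *)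
pose op (x : option ('I_N * 'I_N)) : 'B(H) :=
  if x is Some p then rank1 (e p.2) (e p.1) else bop1 H.
have op_alg o : alg_A (op o).
  by case: o => [p|]; [exact: alg_A_rank1|exact: alg_A_bop1].
have op_contr o : contraction (op o).
  case: o => [p|] y //; rewrite /= rnormZ e1 mulr1.
  by rewrite (le_trans (cauchy_schwarz _ _))// e1 mulr1.
have pV (w : pairs) : rnorm (sval w).1 = 1 /\ rnorm (sval w).2 = 1.
  by have [w1 w2] := svalP w; split; exact: V1r.
have [|c d d0||n [w [t [n0 t0 t1 ht]]]] := @convex_approx R _ pairs (rho \o op)
  (fun w o => omega dotp (sval w).1 (sval w).2 (op o)) 1 W0 _ _ (b ^+ 2 / 2).
- by move=> w o; have [w1 w2] := pV w; exact: omega_contraction.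
- have AX : alg_A (\sum_o c o *: op o) by apply: alg_A_sum => o; exact: alg_AZ.
  have [w] := exists_nearly_norming W0 AX d0.
  by rewrite scalar_sumZ omega_sumZ; exists w.
- by rewrite divr_gt0// exprn_gt0.
pose xi i := (sval (w i)).1; pose eta i := (sval (w i)).2.
have xi1 i : rnorm (xi i) = 1 by have [] := pV (w i).
have eta1 i : rnorm (eta i) = 1 by have [] := pV (w i).
have close o : rnorm (rho (op o) - mixture t xi eta (op o)) <= b ^+ 2 / 2.
  exact: ht.
(* The tolerance b^2/2 at the identity is exactly what [mixture_swap_bound] needs to give [b]. *)
have swap X : contraction X -> rnorm (mixture t xi eta X - mixture t xi xi X) <= b.
  move=> cX; apply: le_trans (mixture_swap _ _ _ cX) _ => //.
  apply: mixture_swap_bound => //; first exact: ltW.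
  by rewrite -rho1; exact: (close None).
have onP X : contraction X ->
    rnorm (rho (compress e X) - mixture t xi xi (compress e X)) <= a ^+ 2 / 2.
  move=> cX; apply: le_trans (rnorm_distD (mixture t xi eta (compress e X)) _ _) _.
  apply: le_trans bm; rewrite mulrDr mulr1 lerD ?swap//; last first.
    exact: compress_contraction.
  rewrite {1 2}/compress scalar_sumZ mixture_sumZ -sumrB.
  apply: le_trans (rnorm_sum _ _ _) _; rewrite mulrC /m -sum1_card natr_sum.
  rewrite mulr_suml ler_sum// => p _; rewrite mul1r -mulrBr rnormM.
  apply: (@le_trans _ _ (1 * (b ^+ 2 / 2))); last by nra.
  (* The coefficients of [compress e X] are matrix entries of a contraction at unit vectors, hence
     at most 1. *)
  rewrite ler_pM ?rnorm_ge0//; last exact: (close (Some p)).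
  exact: omega_contraction.
have c1 : contraction (bop1 H) by move=> x.
have off X : contraction X ->
    rnorm (mixture t xi xi (compress e X) - mixture t xi xi X) <= 2 * a.
  move=> cX; apply: le_trans (mixture_compress _ _ oe cX) _ => //.
  rewrite ler_pM2l//; apply: mixture_compress_bound => //; first exact: ltW.
  (* At the identity, a^2/2 for compressing [rho] and a^2/2 from [onP] give the required a^2. *)
  rewrite -{1}rho1; apply: le_trans (rnorm_distD (rho (compress e (bop1 H))) _ _) _.
  by rewrite (splitr (a ^+ 2)) lerD ?onP// ltW// he.
exists n, xi, t; split=> //; first by move=> i; have [] := svalP (w i).
apply: ge_ereal_sup => _ [X /= /opnorm_contraction cX <-]; rewrite lee_fin.
rewrite -/(mixture t xi xi X).
apply: le_trans (rnorm_distD (rho (compress e X)) _ _) _.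
have h1 := he X cX.
have h2 := rnorm_distD (mixture t xi xi (compress e X)) (rho (compress e X))
  (mixture t xi xi X).
have h3 := onP X cX; have h4 := off X cX.
have aa : a ^+ 2 <= a by rewrite expr2 ler_piMl// ltW.
by lra.
Qed.

End Entanglement.

End InnerProduct.

Theorem theorem6p2 (R : realType) (H : completeNormedModType R[i])
    (dotp : {dot H for (@conjC R[i])})
    (dotp_norm : forall x : H, `|x| ^+ 2 = dotp x x)
    (H_neq0 : exists x : H, x != 0)
    (V : set H)
    (V_unit : forall xi, V xi -> `|xi| = 1)
    (V_closed : closed V)
    (V1 : forall (lambda : R[i]) (xi : H), `|lambda| = 1 -> V xi ->
            V (lambda *: xi))
    (V2 : forall xi : H, (forall eta, V eta -> dotp xi eta = 0) -> xi = 0)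
    (rho : {scalar 'B(H)}) (rho_normal : normal_state dotp rho) :
  correlated dotp V rho <-> entanglement dotp V rho = 1%:E.
Proof.
have [_ rho1 rho_uw] := rho_normal.
split=> [|E1]; first exact: correlated_entanglement.
(* V is inhabited: otherwise the premise of V2 holds vacuously and every vector is 0. *)
apply: entanglement_correlated => //; apply: contrapT => noV.
have [x /eqP[]] := H_neq0; apply: V2 => eta Veta.
by case: noV; constructor; exists (eta, eta).
Qed.
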